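(* Let $n\ge 2$ be an integer. Let $\mathfrak{A}$ and $\mathfrak{A}'$ be two $C^*$-algebras with identities $I_{\mathfrak{A}}$ and $I_{\mathfrak{A}'}$, respectively, and let $P_1$ and $P_2=I_{\mathfrak{A}}-P_1$ be nontrivial projections in $\mathfrak{A}$. Let $\varphi:\mathfrak{A}\to\mathfrak{A}'$ be a bijective unital map (not assumed additive). Suppose that for each $i\in\{1,2\}$: for $X\in\mathfrak{A}$, $X\mathfrak{A}P_i=\{0\}$ implies $X=0$; and for $Y\in\mathfrak{A}'$, $Y\mathfrak{A}'\varphi(P_i)=\{0\}$ implies $Y=0$. If $$\varphi(q_{n*}(I_{\mathfrak{A}},\dots,I_{\mathfrak{A}},A,B))=q_{n*}(\varphi(I_{\mathfrak{A}}),\dots,\varphi(I_{\mathfrak{A}}),\varphi(A),\varphi(B))$$ and $$\varphi(q_{n*}(P,\dots,P,A,B))=q_{n*}(\varphi(P),\dots,\varphi(P),\varphi(A),\varphi(B))$$ for all $A,B\in\mathfrak{A}$ and $P\in\{P_1,P_2\}$, then $\varphi$ is a $*$-ring isomorphism.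
   Context: $C^*$-algebras are complex. For elements $A,B$ of a $*$-ring, $\{A,B\}_*:=AB+BA^*$ (the $*$-Jordan product). Define $q_{1*}(x)=x$ and $q_{n*}(x_1,\dots,x_n)=\{q_{(n-1)*}(x_1,\dots,x_{n-1}),x_n\}_*$ for $n\ge 2$. In $q_{n*}(T,\dots,T,A,B)$ the element $T$ appears $n-2$ times (so for $n=2$ the expression is $q_{2*}(A,B)$). A projection is a self-adjoint idempotent; it is nontrivial if it is neither $0$ nor the identity. Unital means $\varphi(I_{\mathfrak{A}})=I_{\mathfrak{A}'}$. A $*$-ring isomorphism is a bijective map that is additive, multiplicative and satisfies $\varphi(A^* )=\varphi(A)^*$ (complex linearity is not required). *)

(* Defs.v *)
From HB Require Import structures.
From mathcomp Require Import all_boot all_order all_algebra.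
From mathcomp Require Import complex.
From mathcomp Require Import all_classical all_reals all_analysis.

Set Implicit Arguments.
Unset Strict Implicit.
Unset Printing Implicit Defensive.

Import Order.TTheory GRing.Theory Num.Theory.
Import numFieldNormedType.Exports.
Import ComplexField.Normc.

Local Open Scope classical_set_scope.
Local Open Scope ring_scope.
Local Open Scope complex_scope.

HB.mixin Record NzRing_isStarRing A of GRing.NzRing A := {
  star : A -> A;
  starK : involutive star;
  starD : {morph star : x y / x + y};
  starM : forall x y : A, star (x * y) = star y * star x
}.

#[short(type="starRingType")]
HB.structure Definition StarRing := {A of GRing.NzRing A & NzRing_isStarRing A}.

(* The norm is a field of the mixin, not the norm of a normedModType: HB refuses
   a structure joining a ring with a normed Z-module, because Num.NumDomain
   already joins the two without an intermediate structure. *)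
HB.mixin Record StarRing_isCStarAlgebra (R : realType) A
    of StarRing A & GRing.Algebra R[i] A := {
  starZ : forall (a : R[i]) (x : A), star (a *: x) = Num.conj a *: star x;
  cnorm : A -> R;
  cnorm_ge0 : forall x : A, 0 <= cnorm x;
  cnorm_eq0 : forall x : A, cnorm x = 0 -> x = 0;
  cnormD : forall x y : A, cnorm (x + y) <= cnorm x + cnorm y;
  cnormZ : forall (a : R[i]) (x : A), cnorm (a *: x) = normc a * cnorm x;
  cnormM : forall x y : A, cnorm (x * y) <= cnorm x * cnorm y;
  cstar_identity : forall x : A, cnorm (star x * x) = cnorm x ^+ 2;
  cnorm_complete : forall u : nat -> A,
    (forall e : R, 0 < e -> \forall m & n \near \oo, cnorm (u m - u n) < e) ->
    exists l : A, cnorm (u n - l) @[n --> \oo] --> (0 : R)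
}.

(* Unital complex C*-algebras.  Like every algType, they satisfy 1 != 0. *)
#[short(type="cstarAlgType")]
HB.structure Definition CStarAlgebra (R : realType) :=
  {A of StarRing A & GRing.Algebra R[i] A & StarRing_isCStarAlgebra R A}.

Section StarRingDefs.
Variable A : starRingType.

Definition star_jordan (x y : A) : A := x * y + y * star x.

(* q_{n*}(x_1, ..., x_n) for the sequence s = [:: x_1; ...; x_n], n = size s;
   the value 0 on the empty sequence is a dummy. *)
Definition qstar (s : seq A) : A :=
  if s is x :: s' then foldl star_jordan x s' else 0.

Lemma qstar1 (x : A) : qstar [:: x] = x.
Proof. by []. Qed.

Lemma qstar_rcons (s : seq A) (x : A) : (0 < size s)%N ->
  qstar (rcons s x) = star_jordan (qstar s) x.
Proof. by case: s => // y s _; rewrite /= foldl_rcons. Qed.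

Definition qstar_rep (n : nat) (t a b : A) : A :=
  qstar (nseq (n - 2) t ++ [:: a; b]).

Definition projection (p : A) : Prop := star p = p /\ p * p = p.

Definition nontrivial_projection (p : A) : Prop :=
  [/\ projection p, p <> 0 & p <> 1].

End StarRingDefs.

Definition star_ring_isomorphism (A B : starRingType) (f : A -> B) : Prop :=
  [/\ bijective f, {morph f : x y / x + y}, {morph f : x y / x * y}
    & {morph f : x / star x}].

(* Main.v *)
Require Import Defs.
From HB Require Import structures.
From mathcomp Require Import all_boot all_order all_algebra.
From mathcomp Require Import complex.
From mathcomp Require Import all_classical all_reals all_analysis.

Import GRing.Theory.
Local Open Scope ring_scope.

(** The argument is purely algebraic and runs on the normalized product
    x o y = (x y + y x^* )/2, written [half_jordan x y], which has 1 as a left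
    unit, reduces to the Jordan product when [x] is self-adjoint, and to
    half a commutator when [x] is skew-adjoint.

    Since 1 is a unit for the star-Jordan product up to the factor 2, the
    word in 1, ..., 1, a, b is 2^(n-2) {a, b}, with {a, b} = a b + b a^*;
    putting a = 1 shows that [phi] commutes with multiplication by 2^(n-1),
    and so [phi] preserves [half_jordan] itself, whatever [n] is.

    Additivity follows a method of Martindale. Write q = 1 - p. If
    phi t = phi a + phi b, then multiplying by any phi x on the left gives
    phi (x o t) = phi (x o a) + phi (x o b); choosing x so that one of the summands
    dies forces t = a + b, one Peirce component at a time. The elements p, q
    and p - q separate the two diagonal corners and the off-diagonal part
    ([phi_add_corners], [phi_add_diag_off]). On the off-diagonal part,
    expanding (p + 2k) o (c q + 2m) with k self-adjoint makes the sum
    m + c k appear, and every element is h + i k ([phi_add_off]). Inside a corner,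
    multiplication by off-diagonal elements leads back to the previous case,
    and fullness of the opposite projection shows that these multiplications
    separate the points of the corner ([phi_add_corner]).

    Once [phi] is additive it preserves real parts, hence the involution.
    The element j = phi i is skew-adjoint and central because i is, and
    phi (i h) = j phi h for h self-adjoint. The operator x |-> {i p, x}, applied
    twice, is -1 on off-diagonal elements, so j^2 + 1 annihilates the
    off-diagonal part of the target and vanishes by fullness ([phi_i_sqr]).
    Therefore phi (i x) = j phi x for all x, and the products by h and by
    i h give the Jordan product and the commutator of h with any y; their sum
    yields phi (h y) = phi h phi y. *)

(** * The normalized star-Jordan product *)

Definition half_jordan {R : realType} {A : cstarAlgType R} (x y : A) : A :=
  2^-1 *: star_jordan x y.

(** For a projection p this single equation is equivalent to
    x = p x (1 - p) + (1 - p) x p: the operator x |-> p x + x p has eigenvalues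
    2, 0 and 1 on the two corners and on the off-diagonal part. *)
Definition off_diagonal {R : realType} {A : cstarAlgType R} (p x : A) : Prop :=
  p * x + x * p = x.

Definition in_corner {R : realType} {A : cstarAlgType R} (p x : A) : Prop :=
  p * x = x /\ x * p = x.

(** For a projection p this says that the two-sided ideal generated by p has
    trivial left annihilator. *)
Definition full_element {R : realType} {A : cstarAlgType R} (p : A) : Prop :=
  forall x : A, (forall t : A, x * t * p = 0) -> x = 0.

Section HalfJordan.
Set Implicit Arguments.
Unset Strict Implicit.
Variables (R : realType) (A : cstarAlgType R).
Implicit Types x y z p : A.

Lemma two_neq0 : (2 : R[i]) != 0.
Proof. by rewrite Num.Theory.pnatr_eq0. Qed.

Lemma conj_half : Num.conj (2^-1 : R[i]) = 2^-1.
Proof. by rewrite fmorphV rmorph_nat. Qed.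

Lemma halfD x : 2^-1 *: (x + x) = x.
Proof.
by rewrite -mulr2n -(scaler_nat _ x) scalerA mulVf ?two_neq0 ?scale1r.
Qed.

Lemma scaler_half_inj x y : (2^-1 : R[i]) *: x = 2^-1 *: y -> x = y.
Proof. by apply: scalerI; rewrite invr_eq0 two_neq0. Qed.

Lemma addrr_inj x y : x + x = y + y -> x = y.
Proof. by move=> e; rewrite -(halfD x) e halfD. Qed.

Lemma starN x : star (- x) = - star x.
Proof. by rewrite -scaleN1r starZ rmorphN rmorph1 scaleN1r. Qed.

Lemma starB x y : star (x - y) = star x - star y.
Proof. by rewrite starD starN. Qed.

Lemma star0 : star (0 : A) = 0.
Proof. by rewrite -{1}(subrr (0 : A)) starB subrr. Qed.

Lemma star1 : star (1 : A) = 1.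
Proof. by rewrite -[LHS]mulr1 -[X in _ * X]starK -starM mulr1 starK. Qed.

Lemma star_jordanDl x y z :
  star_jordan (x + y) z = star_jordan x z + star_jordan y z.
Proof. by rewrite /star_jordan starD mulrDl mulrDr addrACA. Qed.

Lemma star_jordanZr (c : R[i]) x y :
  star_jordan x (c *: y) = c *: star_jordan x y.
Proof. by rewrite /star_jordan -scalerAr -scalerAl scalerDr. Qed.

Lemma star_jordanZl (c : R[i]) x y :
  Num.conj c = c -> star_jordan (c *: x) y = c *: star_jordan x y.
Proof.
by move=> cc; rewrite /star_jordan starZ cc -scalerAr -scalerAl scalerDr.
Qed.

Lemma half_jordanDl x y z :
  half_jordan (x + y) z = half_jordan x z + half_jordan y z.
Proof. by rewrite /half_jordan star_jordanDl scalerDr. Qed.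

Lemma half_jordanDr x y z :
  half_jordan x (y + z) = half_jordan x y + half_jordan x z.
Proof.
by rewrite /half_jordan /star_jordan mulrDr mulrDl addrACA scalerDr.
Qed.

Lemma half_jordanZr (c : R[i]) x y :
  half_jordan x (c *: y) = c *: half_jordan x y.
Proof. by rewrite /half_jordan star_jordanZr !scalerA mulrC. Qed.

Lemma half_jordanBr x y z :
  half_jordan x (y - z) = half_jordan x y - half_jordan x z.
Proof. by rewrite half_jordanDr -scaleN1r half_jordanZr scaleN1r. Qed.

Lemma half_jordanr0 x : half_jordan x 0 = 0.
Proof. by rewrite -{1}(subrr (0 : A)) half_jordanBr subrr. Qed.

Lemma half_jordan0l x : half_jordan 0 x = 0.
Proof.
by rewrite /half_jordan /star_jordan star0 mul0r mulr0 addr0 scaler0.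
Qed.

Lemma half_jordan1l x : half_jordan 1 x = x.
Proof. by rewrite /half_jordan /star_jordan star1 mul1r mulr1 halfD. Qed.

Lemma half_jordan_comm x y :
  star x = x -> x * y = y * x -> half_jordan x y = x * y.
Proof. by move=> sx xy; rewrite /half_jordan /star_jordan sx -xy halfD. Qed.

Lemma half_jordan_double x y :
  star_jordan x y = half_jordan x y + half_jordan x y.
Proof. by rewrite /half_jordan -scalerDr halfD. Qed.

Lemma star_subr1 p : star p = p -> star (1 - p) = 1 - p.
Proof. by move=> sp; rewrite starB star1 sp. Qed.

Lemma projectionC p : projection p -> projection (1 - p).
Proof.
case=> sp pp; split; first exact: star_subr1.
by rewrite mulrBr mulr1 mulrBl mul1r pp subrr subr0.
Qed.

Lemma projection_mulC p : projection p -> p * (1 - p) = 0.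
Proof. by case=> _ pp; rewrite mulrBr mulr1 pp subrr. Qed.

Lemma projection_Cmul p : projection p -> (1 - p) * p = 0.
Proof. by case=> _ pp; rewrite mulrBl mul1r pp subrr. Qed.

Lemma half_jordan_reflection p x : star p = p ->
  half_jordan (p - (1 - p)) x = p * x + x * p - x.
Proof.
move=> sp; rewrite /half_jordan /star_jordan starB star_subr1 // sp.
have -> : p - (1 - p) = (p + p) - 1 by rewrite opprB addrCA addrA.
rewrite mulrBl mulrBr mul1r mulr1 mulrDl mulrDr addrACA -opprD.
by rewrite (addrACA (p * x)) scalerBr !halfD.
Qed.

Definition re_part (x : A) : A := 2^-1 *: (x + star x).
Definition im_part (x : A) : A := re_part (- 'i *: x).

Lemma star_re_part x : star (re_part x) = re_part x.
Proof. by rewrite /re_part starZ conj_half starD starK addrC. Qed.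

Lemma star_im_part x : star (im_part x) = im_part x.
Proof. exact: star_re_part. Qed.

Lemma re_part_id x : star x = x -> re_part x = x.
Proof. by rewrite /re_part => ->; rewrite halfD. Qed.

Lemma scale_ii x : 'i *: ('i *: x) = - x.
Proof. by rewrite scalerA -expr2 Num.Theory.sqrCi scaleN1r. Qed.

Lemma starZi x : star ('i *: x) = - ('i *: star x).
Proof. by rewrite starZ Num.Theory.conjCi scaleNr. Qed.

Lemma re_im_partE x : x = re_part x + 'i *: im_part x.
Proof.
rewrite /im_part /re_part !scaleNr starN starZi opprK.
rewrite scalerA mulrC -scalerA [X in _ + _ *: X]scalerDr scalerN !scale_ii.
by rewrite opprK -scalerDr addrACA subrr addr0 halfD.
Qed.

Lemma half_jordan_re x : half_jordan x 1 = re_part x.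
Proof. by rewrite /half_jordan /star_jordan mulr1 mul1r. Qed.

End HalfJordan.

(** * Peirce decomposition with respect to a projection *)

Section Peirce.
Set Implicit Arguments.
Unset Strict Implicit.
Variables (R : realType) (A : cstarAlgType R) (p : A).
Hypothesis prp : projection p.
Implicit Types x y d n m : A.

Let sp : star p = p. Proof. by case: prp. Qed.
Let pp : p * p = p. Proof. by case: prp. Qed.

Lemma off_diagonal_mull n : off_diagonal p n -> p * n = n * (1 - p).
Proof. by move=> on; rewrite mulrBr mulr1 -{2}on addrK. Qed.

Lemma off_diagonalC n : off_diagonal p n -> off_diagonal (1 - p) n.
Proof.
rewrite /off_diagonal mulrBl mulrBr mul1r mulr1 addrACA -opprD => ->.
by rewrite addrK.
Qed.

Lemma off_diagonalD n m :
  off_diagonal p n -> off_diagonal p m -> off_diagonal p (n + m).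
Proof. by move=> on om; rewrite /off_diagonal mulrDr mulrDl addrACA on om. Qed.

Lemma off_diagonalZ (c : R[i]) n : off_diagonal p n -> off_diagonal p (c *: n).
Proof.
by move=> on; rewrite /off_diagonal -scalerAr -scalerAl -scalerDr on.
Qed.

Lemma off_diagonal_star n : off_diagonal p n -> off_diagonal p (star n).
Proof.
by move=> on; rewrite /off_diagonal -{1 2}sp -!starM -starD addrC on.
Qed.

Lemma off_diagonal_re n : off_diagonal p n -> off_diagonal p (re_part n).
Proof.
by move=> on; apply/off_diagonalZ/off_diagonalD => //; apply: off_diagonal_star.
Qed.

Lemma off_diagonal_im n : off_diagonal p n -> off_diagonal p (im_part n).
Proof. by move=> on; apply/off_diagonal_re/off_diagonalZ. Qed.

Lemma half_jordan_off n : off_diagonal p n -> half_jordan p n = 2^-1 *: n.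
Proof. by rewrite /half_jordan /star_jordan sp => ->. Qed.

Lemma off_diagonal_mul n m :
  off_diagonal p n -> off_diagonal p m -> p * (n * m) = n * m * p.
Proof.
move=> on om; rewrite mulrA off_diagonal_mull // -mulrA mulrBl mul1r.
have -> : m - p * m = m * p by rewrite -{1}om addrC addKr.
by rewrite mulrA.
Qed.

Lemma half_jordan_off_off n m : off_diagonal p n -> off_diagonal p m ->
  p * half_jordan n m = half_jordan n m * p.
Proof.
move=> on om; rewrite /half_jordan -scalerAr -scalerAl; congr (_ *: _).
rewrite /star_jordan mulrDr mulrDl !off_diagonal_mul //.
exact: off_diagonal_star.
Qed.

Lemma half_jordan_off_diag n d : off_diagonal p n -> p * d = d * p ->
  off_diagonal p (half_jordan n d).
Proof.
move=> on pd; apply: off_diagonalZ; rewrite /off_diagonal /star_jordan.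
rewrite mulrDr mulrDl addrACA !mulrA -(mulrA n) -pd mulrA -mulrDl on.
by rewrite pd -!mulrA -mulrDr off_diagonal_star.
Qed.

Lemma half_jordan_diag d : p * d = d * p -> half_jordan p d = p * d.
Proof. exact: half_jordan_comm. Qed.

Lemma comm_complement d : p * d = d * p -> (1 - p) * d = d * (1 - p).
Proof. by move=> pd; rewrite mulrBl mulrBr mul1r mulr1 pd. Qed.

Lemma half_jordan_diagC d : p * d = d * p ->
  half_jordan p (half_jordan (1 - p) d) = 0.
Proof.
move=> pd; have qd := comm_complement pd.
have pq := projection_mulC prp; have qp := projection_Cmul prp.
rewrite (half_jordan_comm (star_subr1 sp) qd).
rewrite half_jordan_diag mulrA pq mul0r //.
by rewrite qd -mulrA qp mulr0.
Qed.

Lemma half_jordan_reflection_off n : off_diagonal p n ->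
  half_jordan (p - (1 - p)) n = 0.
Proof. by move=> on; rewrite half_jordan_reflection // on subrr. Qed.

(** The operator of p - (1 - p) fixes one corner, negates the other, and has the
    off-diagonal elements as its kernel, where p o ((1 - p) o _) is the scalar
    1/4; so the two operators have no common kernel. *)
Lemma peirce_inj x y :
  half_jordan (p - (1 - p)) x = half_jordan (p - (1 - p)) y ->
  half_jordan p (half_jordan (1 - p) x)
    = half_jordan p (half_jordan (1 - p) y) ->
  x = y.
Proof.
move=> /eqP; rewrite -subr_eq0 -half_jordanBr half_jordan_reflection //.
rewrite subr_eq0 => /eqP ow /eqP.
rewrite -subr_eq0 -!half_jordanBr.
have oq : half_jordan (1 - p) (x - y) = 2^-1 *: (x - y).
  rewrite /half_jordan /star_jordan star_subr1 //.
  by congr (_ *: _); apply: off_diagonalC.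
rewrite oq half_jordanZr half_jordan_off // !scaler_eq0.
by rewrite !invr_eq0 !(negbTE (two_neq0 _)) /= subr_eq0 => /eqP.
Qed.

(** Left multiplication of p x + x p = 2 x by p gives p x p = p x, and right
    multiplication gives p x p = x p. *)
Lemma half_jordan_in_corner x : half_jordan p x = x -> in_corner p x.
Proof.
move=> e.
have {e} e : p * x + x * p = x + x.
  by apply: scaler_half_inj; rewrite halfD -[RHS]e /half_jordan /star_jordan sp.
have pxp : p * x = p * x * p.
  have := congr1 (fun z => p * z) e; rewrite !mulrDr !mulrA pp.
  by move=> /addrI.
have ppx : x * p = p * x * p.
  have := congr1 (fun z => z * p) e; rewrite !mulrDl -!mulrA pp.
  by move=> /addIr; rewrite mulrA.
have px_xp : p * x = x * p by rewrite pxp ppx.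
split; apply: addrr_inj; rewrite -e; first by rewrite {2}px_xp.
by rewrite px_xp.
Qed.

Lemma half_jordan_corner x : in_corner p x -> half_jordan p x = x.
Proof. by case=> px xp; rewrite half_jordan_comm // px. Qed.

Lemma half_jordan_cornerC x : in_corner (1 - p) x -> half_jordan p x = 0.
Proof.
have pq := projection_mulC prp; have qp := projection_Cmul prp.
case=> qx xq; rewrite half_jordan_comm //.
  by rewrite -qx mulrA pq mul0r.
by rewrite -{1}qx -xq mulrA pq mul0r -mulrA qp mulr0.
Qed.

(** With z = i this gives -n, so applying an additive map that sends i p to z p
    tells how z^2 acts on off-diagonal elements. *)
Lemma star_jordan_skew_twice z n : star z = - z -> (forall y, z * y = y * z) ->
  off_diagonal p n ->
  star_jordan (z * p) (star_jordan (z * p) n) = z * z * n.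
Proof.
move=> sz cz on.
have sjE y : star_jordan (z * p) y = z * (p * y - y * p).
  rewrite /star_jordan starM sz sp mulrN -cz !mulrN mulrBr.
  by rewrite (mulrA y) -cz !mulrA.
have pnp : p * n * p = 0.
  by rewrite off_diagonal_mull // -mulrA projection_Cmul // mulr0.
have off2 : p * (p * n - n * p) - (p * n - n * p) * p = n.
  rewrite mulrBr mulrBl !mulrA pp pnp subr0 sub0r opprK -[n * p * p]mulrA pp.
  exact: on.
rewrite !sjE (mulrA p z) -cz -(mulrA z p) -(mulrA z _ p) -mulrBr off2.
by rewrite mulrA.
Qed.

Lemma off_diagonal_corner y : off_diagonal p (p * y * (1 - p)).
Proof.
rewrite /off_diagonal -[_ * p]mulrA projection_Cmul // mulr0 addr0.
by rewrite !mulrA pp.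
Qed.

End Peirce.

(** * Additivity of bijections preserving the product *)

Section HalfJordanMaps.
Set Implicit Arguments.
Unset Strict Implicit.
Variables (R : realType) (A A' : cstarAlgType R) (phi : A -> A').
Hypothesis bij_phi : bijective phi.
Hypothesis phi1 : phi 1 = 1.
Hypothesis phiJ : forall x y,
  phi (half_jordan x y) = half_jordan (phi x) (phi y).
Implicit Types p x y t a b d n m k : A.

Let inj_phi : injective phi. Proof. exact: bij_inj bij_phi. Qed.

Lemma phi_surj (y : A') : exists x, phi x = y.
Proof. by case: bij_phi => g _ gK; exists (g y); rewrite gK. Qed.

Lemma phi0 : phi 0 = 0.
Proof.
have [z z0] := phi_surj 0.
by rewrite -{1}(half_jordan0l z) phiJ z0 half_jordanr0.
Qed.

Lemma phi_re x : phi (re_part x) = re_part (phi x).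
Proof. by rewrite -!half_jordan_re phiJ phi1. Qed.

Lemma phi_selfadjoint x : star x = x -> star (phi x) = phi x.
Proof. by move=> sx; rewrite -(re_part_id sx) phi_re star_re_part. Qed.

Lemma phi_projection p : projection p -> projection (phi p).
Proof.
case=> sp pp; split; first exact: phi_selfadjoint.
rewrite -half_jordan_comm ?phi_selfadjoint // -phiJ half_jordan_comm //.
by rewrite pp.
Qed.

(** The transfer principle behind every additivity step: a relation
    phi t = phi a + phi b can be multiplied on the left by any element. *)
Lemma phi_sum_jordan x t a b : phi t = phi a + phi b ->
  phi (half_jordan x t) = phi (half_jordan x a) + phi (half_jordan x b).
Proof. by move=> e; rewrite !phiJ e half_jordanDr. Qed.

(** The products by p and by 1 - p recover a and b from a + b, and their sum is
    the identity. *)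
Lemma phi_add_corners p a b : projection p ->
  in_corner p a -> in_corner (1 - p) b -> phi (a + b) = phi a + phi b.
Proof.
move=> prp ca cb; have prq := projectionC prp.
have [t te] := phi_surj (phi a + phi b).
have ta : half_jordan p t = a.
  apply: inj_phi; rewrite (phi_sum_jordan p te) half_jordan_corner //.
  by rewrite half_jordan_cornerC // phi0 addr0.
have tb : half_jordan (1 - p) t = b.
  apply: inj_phi; rewrite (phi_sum_jordan (1 - p) te).
  rewrite (half_jordan_cornerC prq) ?subKr // phi0 add0r.
  by rewrite half_jordan_corner.
by rewrite -te -ta -tb -half_jordanDl addrC subrK half_jordan1l.
Qed.

(** The product by p - (1 - p) kills n and is injective on diagonal elements;
    the product by 1 - p followed by the one by p kills d and is injective on
    off-diagonal elements. *)
Lemma phi_add_diag_off p d n : projection p ->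
  p * d = d * p -> off_diagonal p n -> phi (d + n) = phi d + phi n.
Proof.
move=> prp pd on; have [sp _] := prp.
have [t te] := phi_surj (phi d + phi n).
rewrite -te; congr phi; apply: (peirce_inj prp); rewrite !half_jordanDr.
  rewrite (half_jordan_reflection_off prp on) addr0; apply: inj_phi.
  rewrite (phi_sum_jordan _ te) (half_jordan_reflection_off prp on).
  by rewrite phi0 addr0.
rewrite (half_jordan_diagC prp pd) add0r; apply: inj_phi.
rewrite (phi_sum_jordan p (phi_sum_jordan (1 - p) te)).
by rewrite (half_jordan_diagC prp pd) phi0 add0r.
Qed.

(** Expand (p + 2k) o (c (1 - p) + 2m): the off-diagonal terms are
    p o 2m = m and 2k o c (1 - p) = c k, the term p o c (1 - p) vanishes, and
    2k o 2m is diagonal.  Computing the image of this product directly, or as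
    the product of the images, and cancelling the diagonal term leaves the
    claim. *)
Lemma phi_add_off_selfadjoint p (c : R[i]) m k : projection p ->
  off_diagonal p m -> off_diagonal p k -> star k = k ->
  phi (m + c *: k) = phi m + phi (c *: k).
Proof.
move=> prp om ok sk; have [sp pp] := prp.
have oD u : off_diagonal p u -> off_diagonal p (u + u).
  by move=> ou; apply: off_diagonalD.
pose K := k + k; pose y : A := c *: (1 - p); pose M := m + m.
have oK : off_diagonal p K by exact: oD.
have pyC : p * y = y * p.
  by rewrite -scalerAr -scalerAl projection_mulC // projection_Cmul.
have py0 : half_jordan p y = 0.
  have [pq qp] := (projection_mulC prp, projection_Cmul prp).
  by rewrite half_jordanZr half_jordan_comm ?pq ?qp // scaler0.
have pm : half_jordan p M = m.
  by rewrite half_jordan_off ?halfD //; apply: oD.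
have Ky : half_jordan K y = c *: k.
  rewrite half_jordanZr; congr (_ *: _).
  rewrite /half_jordan /star_jordan starD sk addrC.
  by rewrite (off_diagonalC oK) halfD.
have Km : p * half_jordan K M = half_jordan K M * p.
  by apply: half_jordan_off_off => //; apply: oD.
have expand : half_jordan (p + K) (y + M)
    = half_jordan K M + (m + c *: k).
  rewrite (half_jordanDr _ y M) !(half_jordanDl p K) py0 pm Ky add0r.
  by rewrite addrC addrAC addrC.
have ock := off_diagonalZ c ok.
have := phiJ (p + K) (y + M).
rewrite expand (phi_add_diag_off prp Km (off_diagonalD om ock)).
rewrite (phi_add_diag_off prp (erefl (p * p)) oK).
rewrite (phi_add_diag_off prp pyC (oD _ om)).
rewrite half_jordanDr !(half_jordanDl (phi p) (phi K)) -!phiJ py0 pm Ky phi0.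
by rewrite add0r [RHS]addrC [phi m + _]addrC -addrA => /addrI ->; rewrite addrC.
Qed.

Lemma phi_add_off p m n : projection p ->
  off_diagonal p m -> off_diagonal p n -> phi (m + n) = phi m + phi n.
Proof.
move=> prp om on; rewrite (re_im_partE n).
have ore := off_diagonal_re prp on; have oim := off_diagonal_im prp on.
have add_im u : off_diagonal p u ->
    phi (u + 'i *: im_part n) = phi u + phi ('i *: im_part n).
  by move=> ou; exact: (phi_add_off_selfadjoint 'i prp ou oim (star_im_part n)).
rewrite addrA !add_im //; last exact: off_diagonalD.
rewrite -[re_part n]scale1r addrA; congr (_ + _).
exact: (phi_add_off_selfadjoint 1 prp om ore (star_re_part n)).
Qed.

(** If phi t = phi a + phi b, then n o t = n o (a + b) for all off-diagonal n,
    because n o a and n o b are off-diagonal.  For n = (1 - p) x p and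
    d = t - (a + b) this is n d + d n^* = 0, whose left multiple by 1 - p is
    (1 - p) x d = 0; as x is arbitrary and 1 - p is full, d = 0. *)
Lemma phi_add_corner p a b : projection p -> full_element (1 - p) ->
  in_corner p a -> in_corner p b -> phi (a + b) = phi a + phi b.
Proof.
move=> prp fullq [pa ap] [pb bp]; have [sp _] := prp.
have [t te] := phi_surj (phi a + phi b).
have [pt tp] : in_corner p t.
  apply: (half_jordan_in_corner prp); apply: inj_phi.
  by rewrite (phi_sum_jordan p te) te !half_jordan_corner.
pose d := t - (a + b).
have pd : p * d = d by rewrite mulrBr mulrDr pt pa pb.
have dp : d * p = d by rewrite mulrBl mulrDl tp ap bp.
have kill n : off_diagonal p n -> half_jordan n d = 0.
  move=> on; rewrite half_jordanBr; apply/eqP; rewrite subr_eq0; apply/eqP.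
  apply: inj_phi; rewrite (phi_sum_jordan n te) half_jordanDr.
  by rewrite (phi_add_off prp) //; apply: half_jordan_off_diag;
    rewrite // ?pa ?pb.
suff d0 : star d = 0.
  have /eqP : d = 0 by rewrite -(starK d) d0 star0.
  by rewrite subr_eq0 => /eqP tab; rewrite -te tab.
have qd : (1 - p) * d = 0 by rewrite mulrBl mul1r pd subrr.
apply: fullq => x; pose n := (1 - p) * star x * p.
have qn : (1 - p) * n = n by rewrite /n !mulrA (projectionC prp).2.
have np : n * p = n by rewrite -[LHS]mulrA prp.2.
have pn : p * n = 0 by rewrite /n !mulrA projection_mulC // !mul0r.
have on : off_diagonal p n by rewrite /off_diagonal pn np add0r.
have /scaler_half_inj nd : 2^-1 *: star_jordan n d = (2^-1 : R[i]) *: 0.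
  by rewrite scaler0; exact: kill.
have {nd} nd : n * d = 0.
  have := congr1 (fun z => (1 - p) * z) nd.
  rewrite /star_jordan mulrDr mulr0 (mulrA _ n) (mulrA _ d).
  by rewrite qn qd mul0r addr0.
rewrite -[RHS]star0 -nd /n -[in RHS]mulrA pd !starM starK mulrA.
by rewrite star_subr1.
Qed.

Lemma half_jordan_map_additive p : projection p -> full_element p ->
  full_element (1 - p) -> {morph phi : x y / x + y}.
Proof.
move=> prp fullp fullq.
have [sp pp] := prp; have prq := projectionC prp.
have pq := projection_mulC prp; have qp := projection_Cmul prp.
(* naming the complement opaquely keeps distributivity from splitting it *)
have [q qE] : exists q, q = 1 - p by exists (1 - p).
rewrite -qE in fullq prq pq qp.
have pDq : p + q = 1 by rewrite qE addrC subrK.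
have corner e x : projection e -> in_corner e (e * x * e).
  by case=> _ ee; split; [rewrite !mulrA ee | rewrite -(mulrA (e * x)) ee].
pose off x := p * x * q + q * x * p.
have off_off x : off_diagonal p (off x).
  rewrite /off_diagonal /off mulrDr mulrDl !mulrA pp pq !mul0r addr0.
  by rewrite -(mulrA _ q p) -(mulrA _ p p) pp qp mulr0 add0r.
have peirce x : p * x * p + q * x * q + off x = x.
  rewrite /off addrACA -!mulrDr [q + p]addrC pDq !mulr1 -mulrDl pDq.
  by rewrite mul1r.
have split x : phi x = phi (p * x * p) + phi (q * x * q) + phi (off x).
  rewrite -{1}(peirce x) (phi_add_diag_off prp) //.
    by rewrite (phi_add_corners prp) -?qE //; exact: corner.
  rewrite mulrDr mulrDl !mulrA pp pq !mul0r.
  by rewrite -(mulrA _ q p) -(mulrA _ p p) pp qp mulr0.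
move=> x y; rewrite (split x) (split y) (split (x + y)).
have offD : off (x + y) = off x + off y.
  by rewrite /off !mulrDr !mulrDl addrACA.
rewrite offD (phi_add_off prp) // !mulrDr !mulrDl.
have fullCq : full_element (1 - q) by rewrite qE subKr.
have fullCp : full_element (1 - p) by rewrite -qE.
rewrite (phi_add_corner prp fullCp (corner p x prp) (corner p y prp)).
rewrite (phi_add_corner prq fullCq (corner q x prq) (corner q y prq)).
by rewrite [RHS]addrACA; congr (_ + _); rewrite addrACA.
Qed.

(** * Involution, image of the imaginary unit, and multiplicativity *)

Section AdditiveHalfJordanMaps.
Hypothesis phiD : {morph phi : x y / x + y}.

Lemma phiN x : phi (- x) = - phi x.
Proof. by apply/eqP; rewrite -addr_eq0 -phiD addNr phi0. Qed.

Lemma phi_star_jordan x y :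
  phi (star_jordan x y) = star_jordan (phi x) (phi y).
Proof. by rewrite !half_jordan_double phiD phiJ. Qed.

Lemma phi_star x : phi (star x) = star (phi x).
Proof.
have := phi_star_jordan x 1.
by rewrite phi1 /star_jordan !mulr1 !mul1r phiD => /addrI.
Qed.

Let j := phi 'i%:A.

Lemma star_phi_i : star j = - j.
Proof. by rewrite -phi_star starZi star1 phiN. Qed.

(** The product with left factor i is zero, being i y - y i. *)
Lemma phi_i_central (y : A') : j * y = y * j.
Proof.
have [x <-] := phi_surj y.
have := phi_star_jordan 'i%:A x.
rewrite /star_jordan starZi star1 mulrN mulr_algl mulr_algr subrr phi0 -/j.
by rewrite star_phi_i mulrN => /esym/eqP; rewrite subr_eq0 => /eqP.
Qed.

(** Here i is the right factor: {x, i} = 2 i x for x self-adjoint. *)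
Lemma phi_i_selfadjoint x : star x = x -> phi ('i *: x) = j * phi x.
Proof.
move=> sx; apply: addrr_inj; rewrite -phiD.
have := phi_star_jordan x 'i%:A.
by rewrite /star_jordan -phi_star sx mulr_algl mulr_algr -/j -phi_i_central.
Qed.

Lemma phi_off_diagonal p (y : A') : projection p -> off_diagonal (phi p) y ->
  exists2 n, off_diagonal p n & phi n = y.
Proof.
move=> [sp _]; have [n <-] := phi_surj y => oy; exists n => //.
apply: inj_phi; rewrite -[RHS]oy.
have := phi_star_jordan p n.
by rewrite /star_jordan -phi_star sp.
Qed.

Lemma phi_i_sqr_off p (y : A') : projection p -> off_diagonal (phi p) y ->
  j * j * y = - y.
Proof.
move=> prp oy; have [n on yE] := phi_off_diagonal prp oy.
rewrite -(star_jordan_skew_twice (phi_projection prp) star_phi_i _ oy);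
  last exact: phi_i_central.
have [sp _] := prp.
rewrite -phi_i_selfadjoint // -yE -!phi_star_jordan -phiN; congr phi.
rewrite -mulr_algl (star_jordan_skew_twice prp) //.
- by rewrite mulr_algl scale_ii mulN1r.
- by rewrite starZi star1.
- by move=> u; rewrite mulr_algl mulr_algr.
Qed.

(** j^2 + 1 kills p A' (1 - p) and (1 - p) A' p, writing p for its image;
    fullness of both projections gives (j^2 + 1) p = 0 and
    (j^2 + 1) (1 - p) = 0. *)
Lemma phi_i_sqr p : projection p -> full_element (phi p) ->
  full_element (1 - phi p) -> j * j = -1.
Proof.
move=> prp fullp fullq; have prP := phi_projection prp.
have prQ := projectionC prP.
pose z := j * j + 1.
have zoff (y : A') : off_diagonal (phi p) y -> z * y = 0.
  by move=> oy; rewrite mulrDl mul1r (phi_i_sqr_off prp oy) addNr.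
have zP : z * phi p = 0.
  apply: fullq => t; rewrite -(mulrA z) -(mulrA z) zoff //.
  exact: off_diagonal_corner.
have zQ : z * (1 - phi p) = 0.
  apply: fullp => t; rewrite -(mulrA z) -(mulrA z) zoff //.
  by have := off_diagonalC (off_diagonal_corner prQ t); rewrite subKr.
apply/eqP; rewrite -addr_eq0 -/z -[z]mulr1 -(subrK (phi p) 1) mulrDr.
by rewrite zP zQ addr0.
Qed.

(** For x self-adjoint, {x, y} = x y + y x and {i x, y} = i (x y - y x); the sum
    of the two preserved quantities is 2 x y. *)
Lemma half_jordan_map_multiplicative p : projection p -> full_element (phi p) ->
  full_element (1 - phi p) -> {morph phi : x y / x * y}.
Proof.
move=> prp fullp fullq; have jj := phi_i_sqr prp fullp fullq.
have phi_i x : phi ('i *: x) = j * phi x.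
  rewrite (re_im_partE x) scalerDr scale_ii !phiD phiN.
  rewrite !phi_i_selfadjoint ?star_re_part ?star_im_part //.
  by rewrite mulrDr mulrA jj mulN1r.
have mul_sa x y : star x = x -> phi (x * y) = phi x * phi y.
  move=> sx.
  have jordan := phi_star_jordan x y.
  rewrite /star_jordan -phi_star sx phiD in jordan.
  have commutator : phi (x * y) - phi (y * x) = phi x * phi y - phi y * phi x.
    have := phi_star_jordan ('i *: x) y.
    rewrite /star_jordan -phi_star starZi sx phiN phi_i !mulrN.
    rewrite -scalerAr -scalerAl phiD phiN !phi_i.
    rewrite (mulrA (phi y)) -phi_i_central -!mulrA -!mulrBr.
    (* multiplying by j cancels the factor j, up to sign *)
    move=> /(congr1 (fun u => j * u)); rewrite !mulrA jj !mulN1r.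
    exact: oppr_inj.
  apply: addrr_inj.
  have := congr2 +%R jordan commutator.
  rewrite !addrA ![_ + _ + phi (x * y)]addrAC.
  by rewrite ![_ + _ + (phi x * phi y)]addrAC !addrK.
move=> x y; rewrite {1}(re_im_partE x) mulrDl -(scalerAl 'i) phiD phi_i.
rewrite !mul_sa ?star_re_part ?star_im_part // mulrA -mulrDl.
by rewrite -phi_i -phiD -re_im_partE.
Qed.

End AdditiveHalfJordanMaps.

End HalfJordanMaps.

(** * The theorem for n-fold products *)

Lemma qstar_rep1 (R : realType) (A : cstarAlgType R) (n : nat) (a b : A) :
  qstar_rep n 1 a b = (2 ^+ (n - 2) : R[i]) *: star_jordan a b.
Proof.
have conj2X m : Num.conj (2 ^+ m : R[i]) = 2 ^+ m.
  by rewrite rmorphXn rmorph_nat.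
have jordan2X m (x : A) :
    @star_jordan A ((2 ^+ m : R[i]) *: 1) x = (2 ^+ m.+1 : R[i]) *: x.
  rewrite star_jordanZl // /star_jordan star1 mul1r mulr1 exprSr -scalerA.
  by rewrite scaler_nat mulr2n.
have foldl1 k m : foldl (@star_jordan A) ((2 ^+ m : R[i]) *: 1) (nseq k 1)
    = (2 ^+ (m + k) : R[i]) *: 1.
  by elim: k m => [|k IH] m /=; rewrite ?addn0 // jordan2X IH addSnnS.
rewrite /qstar_rep; case: (n - 2)%N => [|k] /=; first by rewrite scale1r.
have := foldl1 k 0; rewrite expr0 scale1r add0n foldl_cat => -> /=.
by rewrite jordan2X star_jordanZl.
Qed.

Theorem theorem2p2 (R : realType) (n : nat) (A A' : cstarAlgType R)
    (P1 P2 : A) (phi : A -> A') :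
  (2 <= n)%N ->
  P2 = 1 - P1 ->
  nontrivial_projection P1 -> nontrivial_projection P2 ->
  bijective phi ->
  phi 1 = 1 ->
  (forall P : A, P \in [:: P1; P2] ->
     (forall X : A, (forall T : A, X * T * P = 0) -> X = 0) /\
     (forall Y : A', (forall T : A', Y * T * phi P = 0) -> Y = 0)) ->
  (forall a b : A,
     phi (qstar_rep n 1 a b) = qstar_rep n (phi 1) (phi a) (phi b)) ->
  (forall P : A, P \in [:: P1; P2] -> forall a b : A,
     phi (qstar_rep n P a b) = qstar_rep n (phi P) (phi a) (phi b)) ->
  star_ring_isomorphism phi.
Proof.
move=> _ P2E [prP1 _ _] _ bij_phi phi1 full q_phi _.
have [fullP1 fullQ1] := full P1 (mem_head _ _).
have [fullP2 fullQ2] : full_element P2 /\ full_element (phi P2).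
  by apply: full; rewrite !inE eqxx orbT.
(* the choice a = 1 turns doubling combined with the factor 2 ^ (n - 2) into an
   operation that commutes with phi *)
have phi_double (b : A) :
    phi ((2 ^+ (n - 2) : R[i]) *: (b + b)) = 2 ^+ (n - 2) *: (phi b + phi b).
  have := q_phi 1 b; rewrite phi1 !qstar_rep1 /star_jordan !star1.
  by rewrite !mul1r !mulr1.
have phiJ (x y : A) : phi (half_jordan x y) = half_jordan (phi x) (phi y).
  have := q_phi x y; rewrite phi1 !qstar_rep1.
  rewrite !half_jordan_double phi_double => /scalerI-/(_ _)/addrr_inj; apply.
  by rewrite expf_neq0 // two_neq0.
have phiD : {morph phi : x y / x + y}.
  by apply: (half_jordan_map_additive bij_phi phiJ prP1); rewrite // -P2E.
have phiP2 : phi P2 = 1 - phi P1.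
  by rewrite P2E phiD (phiN bij_phi phiJ phiD) phi1.
split => //.
  apply: (half_jordan_map_multiplicative bij_phi phi1 phiJ phiD prP1) => //.
  by rewrite -phiP2.
exact: (phi_star phi1 phiJ phiD).
Qed.
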